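(* Let $0<s<1$ and $1<p<\infty$ be such that $sp>1$. Then there exists a constant $C_{s,p}<\infty$, depending only on $s$ and $p$, such that for every continuous function $f\in C^0(\mathbb R,\mathbb R)$, $$\int_{\mathbb R}\int_{\mathbb R}\frac{[\operatorname{osc}_{[x,y]}f]^p}{|y-x|^{1+sp}}\,dx\,dy\le C_{s,p}\int_{\mathbb R}\int_{\mathbb R}\frac{|f(y)-f(x)|^p}{|y-x|^{1+sp}}\,dx\,dy .$$
   Context: For $f\in C^0(\mathbb R,\mathbb R)$ and $x,y\in\mathbb R$, $\operatorname{osc}_{[x,y]}f:=\max\{|f(z)-f(t)|;\ z,t\in[x,y]\}$, where $[x,y]$ denotes the closed interval with endpoints $x$ and $y$ (in either order). The integrals take values in $[0,\infty]$. *)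

(* Defs.v *)
From mathcomp Require Import all_boot all_order all_algebra.
From mathcomp Require Import all_classical all_reals all_analysis.
Set Implicit Arguments.
Unset Strict Implicit.
Unset Printing Implicit Defensive.
Import Order.TTheory GRing.Theory Num.Theory.
Import numFieldNormedType.Exports.
Local Open Scope classical_set_scope.
Local Open Scope ring_scope.

(* The closed interval with endpoints x and y, in either order. *)
Definition segment {R : realType} (x y : R) : set R :=
  [set` `[Num.min x y, Num.max x y]].

(* The supremum is a maximum when f is continuous: see osc_is_max. *)
Definition osc {R : realType} (f : R -> R) (x y : R) : R :=
  sup [set `|f z - f t| | z in segment x y & t in segment x y].

Lemma osc_is_max (R : realType) (f : R -> R) (x y : R) (cf : continuous f) :
  exists z t : R,
  [/\ segment x y z, segment x y t, osc f x y = `|f z - f t| &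
      forall z' t', segment x y z' -> segment x y t' ->
        `|f z' - f t'| <= `|f z - f t|].
Proof.
have mM : Num.min x y <= Num.max x y by rewrite ge_min !le_max lexx.
have cfi : {within `[Num.min x y, Num.max x y], continuous f}.
  exact: continuous_subspaceT.
have [a aI amax] := EVT_max mM cfi.
have [b bI bmin] := EVT_min mM cfi.
have ub z' t' : segment x y z' -> segment x y t' ->
    `|f z' - f t'| <= `|f a - f b|.
  move=> zI tI; rewrite (ger0_norm (_ : 0 <= f a - f b)) ?subr_ge0 ?amax //.
  by rewrite ler_norml opprB !lerB ?amax ?bmin.
exists a, b; split => //.
apply/eqP; rewrite eq_le; apply/andP; split.
- by apply: ge_sup; [exists `|f a - f b|, a => //; exists b|
    move=> _ [z zI [t tI <-]]; exact: ub].
- apply: ub_le_sup; last by exists a => //; exists b.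
  by exists `|f a - f b| => _ [z zI [t tI <-]]; exact: ub.
Qed.

(* Main.v *)
Require Import Defs.
From mathcomp Require Import all_boot all_order all_algebra.
From mathcomp Require Import all_classical all_reals all_analysis.
From mathcomp Require Import measurable_realfun ring lra.
Import Order.TTheory GRing.Theory Num.Theory.
Import numFieldNormedType.Exports.
Local Open Scope classical_set_scope.
Local Open Scope ring_scope.

(* Put g = (s p + 3) / 4 > 1, so that 1 + s p = 4 g - 2, and
     F(u,v) = |f u - f v|^p / |u - v|^(2 g).
   A Garsia-Rodemich-Rumsey chaining argument along the intervals homothetic to
   [x,y] with centre z and ratio 2^-n gives
     osc_[x,y] f ^ p <= M |y - x|^(2 g - 2) \int_[x,y] \int_[x,y] F.
   Divide by |y - x|^(4 g - 2), integrate in x and y and exchange the integrals: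
   it remains to bound, for fixed u <> v, the integral of |y - x|^(-2 g) over the
   (x,y) whose segment contains u and v.  With c = (u + v) / 2 this function is at
   most |y - c|^(-g) |x - c|^(-g) on {|x - c|, |y - c| >= |u - v| / 2}, whose
   integral is a constant multiple of |u - v|^(2 - 2 g). *)

(** The integral of a nonnegative function is a supremum over the simple functions below it, and
    those below [f] are also below [g]. It serves integrands containing [osc], whose measurability
    is never established. *)
Lemma ge0_le_integralT d (T : measurableType d) (R : realType)
    (mu : {measure set T -> \bar R}) (f g : T -> \bar R) :
  (forall x, 0 <= f x)%E -> (forall x, f x <= g x)%E ->
  (\int[mu]_x f x <= \int[mu]_x g x)%E.
Proof.
move=> f0 fg.
rewrite !ge0_integralTE//; last by move=> x; exact: le_trans (f0 x) (fg x).
apply: ge_ereal_sup => _ [h hf <-]; apply: ereal_sup_ubound; exists h => //.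
by move=> x; exact: le_trans (hf x) (fg x).
Qed.

(** * Selection of points by averaging *)

Section mean_value.
Context {R : realType}.
Local Notation mu := (@lebesgue_measure R).

(** Otherwise [f] is at least [K] on the whole interval and its integral is at least
    [K * (b - a) > C]. *)
Lemma exists_lt_mean (a b C K : R) (f : R -> \bar R) :
  a < b -> C < K * (b - a) -> 0 <= K ->
  measurable_fun [set: R] f -> (forall t, 0 <= f t)%E ->
  (\int[mu]_(t in `[a, b]) f t <= C%:E)%E ->
  exists2 t, t \in `[a, b] & (f t < K%:E)%E.
Proof.
move=> ab CK K0 mf f0 fC; apply: contrapT => /forall2NP nex.
have Kf t : t \in `[a, b] -> (K%:E <= f t)%E.
  by move=> tab; have [//|/negP] := nex t; rewrite -leNgt.
have : (\int[mu]_(t in `[a, b]) (cst K%:E t) <= C%:E)%E.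
  apply: le_trans fC; apply: ge0_le_integral => //.
  exact: measurable_funTS.
rewrite integral_cst//= lebesgue_measure_itv/= lte_fin ab -EFinD -EFinM lee_fin.
by rewrite leNgt CK.
Qed.

Lemma measurable_section_integral (F : R * R -> R) (D : set R) :
  measurable D -> measurable_fun [set: R * R] F -> (forall z, 0 <= F z) ->
  measurable_fun [set: R] (fun u => \int[mu]_(v in D) (F (u, v))%:E)%E.
Proof.
move=> mD mF F0.
pose G (w : R * R) := ((F w)%:E * (\1_D w.2)%:E)%E.
rewrite (_ : (fun u => _) = fubini_F mu G); last first.
  apply/funext => u; rewrite /fubini_F /G/= integral_mkcond.
  by apply: eq_integral => v _; rewrite epatch_indic.
apply: measurable_fun_fubini_tonelli_F.
  apply: emeasurable_funM; apply/measurable_EFinP => //.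
  by apply: measurableT_comp => //; exact: measurable_indic.
by move=> w; rewrite /G; apply: mule_ge0; rewrite lee_fin.
Qed.

(* t' is chosen so that J t' + (d / 3) F (t, t') is below its mean bound: this
   controls the next link F (t, t') and keeps the invariant on J. *)
Lemma chain_step (F : R * R -> R) (x y B a b d t : R) :
  measurable_fun [set: R * R] F -> (forall z, 0 <= F z) ->
  let J u := (\int[mu]_(v in `[x, y]) (F (u, v))%:E)%E in
  (\int[mu]_(u in `[x, y]) J u <= B%:E)%E ->
  0 < B -> 0 < d -> x <= a -> a < b -> b <= y ->
  (J t <= (3 * B / d)%:E)%E ->
  exists t', [/\ a <= t' <= b, (J t' <= (3 * B / (b - a))%:E)%E &
     F (t, t') <= 9 * B / (d * (b - a))].
Proof.
move=> mF F0 J JB B0 d0 xa ab yb Jt.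
have sub : `[a, b] `<=` `[x, y].
  by apply: subset_itv; rewrite bnd_simp.
have mF1 u : measurable_fun [set: R] (fun v => F (u, v)).
  exact: measurableT_comp mF (measurable_pair1 _).
have mJ : measurable_fun [set: R] J by exact: measurable_section_integral.
have J0 u : (0 <= J u)%E by apply: integral_ge0 => v _; rewrite lee_fin.
have dF0 t' : (0 <= (d / 3 * F (t, t'))%:E)%E.
  by rewrite lee_fin mulr_ge0// divr_ge0// ltW.
have mdF : measurable_fun [set: R] (fun t' => (d / 3 * F (t, t'))%:E).
  by apply/measurable_EFinP; apply: measurable_funM => //; exact: mF1.
have ba0 : 0 < b - a by rewrite subr_gt0.
(* The weight [d / 3] balances the two terms: each integrates to at most [B] over [[a, b]], so the
   mean is at most [2 * B / (b - a)], strictly below the threshold. *)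
have [|||||t' t'ab] := @exists_lt_mean a b (2 * B) (3 * B / (b - a))
    (fun t' => J t' + (d / 3 * F (t, t'))%:E)%E ab.
- by rewrite divfK ?gt_eqF//; lra.
- by rewrite divr_ge0 ?mulr_ge0 ?(ltW B0) ?(ltW ba0).
- exact: emeasurable_funD.
- by move=> u; rewrite adde_ge0.
- rewrite ge0_integralD//; [|exact: measurable_funTS..].
  rewrite (_ : 2 * B = B + d / 3 * (3 * B / d)); last by field; rewrite gt_eqF.
  rewrite EFinD; apply: leeD.
    apply: le_trans JB; apply: ge0_subset_integral => //.
    exact: measurable_funTS.
  under eq_integral do rewrite EFinM.
  rewrite ge0_integralZl//; last 3 first.
  + by apply/measurable_EFinP; apply: measurable_funTS; exact: mF1.
  + by move=> v _; rewrite lee_fin.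
  + by rewrite lee_fin divr_ge0// ltW.
  rewrite [leRHS]EFinM; apply: lee_wpmul2l; first by rewrite lee_fin divr_ge0// ltW.
  apply: le_trans Jt; apply: ge0_subset_integral => //.
    by apply/measurable_EFinP; apply: measurable_funTS; exact: mF1.
  by move=> v _; rewrite lee_fin.
move=> sumlt; exists t'; split.
- by move: t'ab; rewrite in_itv.
- by apply/ltW/(le_lt_trans _ sumlt); rewrite leeDl.
- have : ((d / 3 * F (t, t'))%:E < (3 * B / (b - a))%:E)%E.
    by apply/(le_lt_trans _ sumlt); rewrite leeDr.
  rewrite lte_fin => /ltW H.
  rewrite (_ : 9 * B / (d * (b - a)) = (3 * B / (b - a)) / (d / 3)); last first.
    by field; rewrite ?gt_eqF.
  by rewrite ler_pdivlMr ?divr_gt0// mulrC.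
Qed.

End mean_value.

(** * Chaining with the Gagliardo kernel and the oscillation bound on an interval *)

Section gagliardo_kernel.
Context {R : realType}.
Local Notation mu := (@lebesgue_measure R).

Lemma powR_half_lt1 (a : R) : 0 < a -> 2^-1 `^ a < 1.
Proof.
move=> a0; have := @gt0_ltr_powR R a a0 2^-1 1; rewrite powR1; apply.
- by rewrite nnegrE invr_ge0.
- by rewrite nnegrE.
- by lra.
Qed.

Lemma powR_geometric (b e p : R) (n : nat) : 0 <= b ->
  (b `^ (e / p)) ^+ n = ((b ^+ n) `^ e) `^ p^-1.
Proof.
move=> b0; rewrite -(powR_mulrn n (powR_ge0 b (e / p))) -(powR_mulrn n b0).
by rewrite -!(powRrM b); congr (_ `^ _); ring.
Qed.

(** For [a = 1 + s * p] this is the integrand of the Gagliardo seminorm of the fractional Sobolev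
    space. The chaining uses [a = 2 * g], the final estimate [a = 4 * g - 2]. *)
Definition gagliardo (f : R -> R) (p a : R) (z : R * R) : R :=
  `|f z.1 - f z.2| `^ p / `|z.1 - z.2| `^ a.

Lemma gagliardo_ge0 f p a z : 0 <= gagliardo f p a z.
Proof. by rewrite /gagliardo divr_ge0 ?powR_ge0. Qed.

Lemma gagliardo_diag f p a u : p != 0 -> gagliardo f p a (u, u) = 0.
Proof. by move=> p0; rewrite /gagliardo/= subrr normr0 powR0// mul0r. Qed.

Lemma measurable_gagliardo f p a : continuous f ->
  measurable_fun [set: R * R] (gagliardo f p a).
Proof.
move=> cf; have mf := continuous_measurable_fun cf.
rewrite (_ : gagliardo f p a =
  (fun z => `|f z.1 - f z.2| `^ p * `|z.1 - z.2| `^ (- a))); last first.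
  by apply/funext => z; rewrite powRN.
apply: measurable_funM; apply: (measurableT_comp (measurable_powR _));
  apply: measurableT_comp => //; apply: measurable_funB => //;
  by apply: measurableT_comp.
Qed.

(** Clearing the denominator, which is at most [d ^ (2 g)], turns the bound [18 B / d ^ 2] on the
    quotient into [18 B d ^ (2 g - 2)] for the [p]-th power of the increment. *)
Lemma gagliardo_increment (f : R -> R) (p g B d t t' : R) :
  0 < p -> 1 < g -> 0 < B -> 0 < d -> `|t - t'| <= d ->
  gagliardo f p (2 * g) (t, t') <= 9 * B / (d * (d / 2)) ->
  `|f t - f t'| <= (18 * B * d `^ (2 * g - 2)) `^ p^-1.
Proof.
move=> p0 g1 B0 d0 tt'; rewrite /gagliardo/= => H.
have [->|nt] := eqVneq t t'; first by rewrite subrr normr0 powR_ge0.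
have ntp : 0 < `|t - t'| by rewrite normr_gt0 subr_eq0.
have -> : `|f t - f t'| = (`|f t - f t'| `^ p) `^ p^-1.
  by rewrite -powRrM mulfV ?gt_eqF// powRr1.
apply: ge0_ler_powR.
- by rewrite invr_ge0 ltW.
- by rewrite nnegrE powR_ge0.
- by rewrite nnegrE !mulr_ge0 ?powR_ge0 ?(ltW B0).
move: H; rewrite ler_pdivrMr ?powR_gt0// => /le_trans; apply.
have -> : 18 * B * d `^ (2 * g - 2) = 9 * B / (d * (d / 2)) * d `^ (2 * g).
  rewrite powRB; last by rewrite (gt_eqF d0) implybT.
  rewrite (_ : (2 : R) = 2%:R)// powR_mulrn ?ltW//.
  by field; rewrite gt_eqF.
apply: ler_wpM2l; first by rewrite divr_ge0// mulr_ge0// ?(ltW B0)// ?divr_ge0// ltW.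
apply: ge0_ler_powR => //; rewrite ?nnegrE ?(ltW d0)//; lra.
Qed.

(** The interval of ratio 1 is [[x, y]] whatever [z] is, so one starting point [t0] serves every
    [z]. The links of the chain are bounded by [A * q ^+ n], with [q < 1] because [g > 1], and these
    bounds sum to [A / (1 - q)]. *)
Lemma gagliardo_chain (f : R -> R) (p g x y B : R) : continuous f ->
  0 < p -> 1 < g -> x < y -> 0 < B ->
  let F := gagliardo f p (2 * g) in
  (\int[mu]_(u in `[x, y]) \int[mu]_(v in `[x, y]) (F (u, v))%:E <= B%:E)%E ->
  let A := (18 * B * (y - x) `^ (2 * g - 2)) `^ p^-1 in
  let q := 2^-1 `^ ((2 * g - 2) / p) in
  exists t0, forall z, x <= z <= y -> `|f z - f t0| <= A / (1 - q).
Proof.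
move=> cf p0 g1 xy B0 F FB A q.
have mF : measurable_fun setT F by exact: measurable_gagliardo.
have F0 w : 0 <= F w by exact: gagliardo_ge0.
pose J u := (\int[mu]_(v in `[x, y]) (F (u, v))%:E)%E.
have h0 : 0 < y - x by rewrite subr_gt0.
have A0 : 0 <= A by exact: powR_ge0.
have q0 : 0 <= q by exact: powR_ge0.
have q1 : q < 1.
  by apply: powR_half_lt1; rewrite divr_gt0//; lra.
have [|||||t0] := @exists_lt_mean R x y B (3 * B / (y - x)) J xy.
- by rewrite divfK ?gt_eqF//; lra.
- by rewrite divr_ge0 ?mulr_ge0 ?(ltW B0) ?(ltW h0).
- exact: measurable_section_integral.
- by move=> u; apply: integral_ge0 => v _; rewrite lee_fin.
- exact: FB.
rewrite in_itv/= => t0xy Jt0.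
exists t0 => z /andP[xz zy].
(* The three clauses locate the point in the interval of ratio [2 ^ -n], keep the invariant on [J]
   that permits the next step, and bound the first [n] links by a partial geometric sum. *)
have chain n : exists t, [/\
    z - (z - x) / 2 ^+ n <= t <= z + (y - z) / 2 ^+ n,
    (J t <= (3 * B / ((y - x) / 2 ^+ n))%:E)%E &
    `|f t - f t0| <= A * (1 - q ^+ n) / (1 - q)].
  elim: n => [|n [t [tab Jt ft]]].
    exists t0; split; [by lra|by rewrite expr0 divr1 ltW|].
    by rewrite subrr normr0 expr0 subrr mulr0 mul0r.
  set d := (y - x) / 2 ^+ n in Jt.
  have e0 : 0 < 2 ^+ n :> R by rewrite exprn_gt0.
  have d0 : 0 < d by rewrite divr_gt0.
  set w : R := (2 ^+ n)^-1 in d d0 Jt tab.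
  have w0 : 0 < w by rewrite invr_gt0.
  have w1 : w <= 1 by rewrite invf_le1// exprn_ege1// ler1n.
  have wS : (2 ^+ n.+1)^-1 = w / 2 :> R by rewrite exprSr invfM.
  rewrite wS.
  (* The next interval has length [d / 2], which gives the link bound of [chain_step] the form
     expected by [gagliardo_increment]. *)
  have ba : z + (y - z) * (w / 2) - (z - (z - x) * (w / 2)) = d / 2.
    by rewrite /d; field.
  have [|||t' [t'ab Jt' Ft']] := @chain_step R F x y B
    (z - (z - x) * (w / 2)) (z + (y - z) * (w / 2)) d t mF F0 FB B0 d0 _ _ _ Jt.
  - by nra.
  - by rewrite -subr_gt0 ba; lra.
  - by nra.
  rewrite ba in Jt' Ft'.
  exists t'; split => //.
    by rewrite (_ : (y - x) * (w / 2) = d / 2)// /d; field.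
  (* The intervals are nested: both points lie in the one of ratio [w], whose length is [d]. *)
  have tt' : `|t - t'| <= d.
    rewrite /d ler_norml; apply/andP; split; nra.
  have := gagliardo_increment f p g B d t t' p0 g1 B0 d0 tt' Ft'.
  rewrite distrC => ft'.
  apply: (le_trans (ler_distD (f t) _ _)).
  have -> : A * (1 - q ^+ n.+1) / (1 - q) =
      A * q ^+ n + A * (1 - q ^+ n) / (1 - q).
    by rewrite exprS; field; lra.
  apply: lerD => //; apply: (le_trans ft').
  have -> : q ^+ n = (w `^ (2 * g - 2)) `^ p^-1.
    have half0 : 0 <= 2^-1 :> R by rewrite invr_ge0.
    by rewrite /q (powR_geometric _ _ _ n half0) /w -exprVn.
  have hw : d `^ (2 * g - 2) = (y - x) `^ (2 * g - 2) * w `^ (2 * g - 2).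
    by rewrite powRM ?(ltW h0) ?(ltW w0).
  rewrite hw /A mulrA powRM ?powR_ge0//.
  by rewrite !mulr_ge0 ?powR_ge0 ?(ltW B0).
(* The points of the chain tend to [z], so continuity of [f] at [z] carries the bound, uniform in
   [n], over to [f z]. *)
apply/ler_addgt0Pr => e e0.
have := cf z => /cvgrPdist_lt /(_ _ e0) /nbhs_ballP [r /= r0 zr].
have [n hn] : exists n, (y - x) / 2 ^+ n < r.
  exists (Num.bound ((y - x) / r)).
  by rewrite ltr_pdivrMr ?exprn_gt0// mulrC -ltr_pdivrMr// upper_nthrootP.
have [t [tab _ ft]] := chain n.
have w0 : 0 < (2 ^+ n)^-1 :> R by rewrite invr_gt0 exprn_gt0.
have fzt : `|f z - f t| < e.
  apply: zr; rewrite /ball/=; apply: le_lt_trans hn.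
  by rewrite ler_norml; apply/andP; split; nra.
apply: (le_trans (ler_distD (f t) _ _)); rewrite addrC; apply: lerD; last exact: ltW.
apply: (le_trans ft); rewrite ler_pM2r ?invr_gt0 ?subr_gt0//.
by rewrite ler_piMr// gerBl exprn_ge0.
Qed.

(** The oscillation is attained at two points where [f] is within [A / (1 - q)] of [f t0], hence is
    at most [2 * A / (1 - q)]. Raising to the power [p] produces [M], which involves only [p] and
    [g]. *)
Lemma osc_le_gagliardo (p g : R) : 0 < p -> 1 < g ->
  exists2 M : R, 0 < M & forall (f : R -> R) (x y B : R), continuous f ->
  x < y -> 0 < B ->
  (\int[mu]_(u in `[x, y]) \int[mu]_(v in `[x, y])
     (gagliardo f p (2 * g) (u, v))%:E <= B%:E)%E ->
  osc f x y `^ p <= M * (y - x) `^ (2 * g - 2) * B.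
Proof.
move=> p0 g1; set q : R := 2^-1 `^ ((2 * g - 2) / p).
have q1 : q < 1.
  by apply: powR_half_lt1; rewrite divr_gt0//; lra.
have c0 : 0 < 2 / (1 - q) by rewrite divr_gt0// subr_gt0.
exists ((2 / (1 - q)) `^ p * 18).
  by rewrite mulr_gt0 ?powR_gt0.
move=> f x y B cf xy B0 FB.
have [t0 ft0] := gagliardo_chain f p g x y B cf p0 g1 xy B0 FB.
have [z [t [zI tI oE _]]] := osc_is_max x y cf.
have seg w : segment x y w -> x <= w <= y.
  by rewrite /segment/= in_itv/= (min_idPl (ltW xy)) (max_idPr (ltW xy)).
set A := _ `^ p^-1 in ft0; rewrite -/q in ft0.
have oA : osc f x y <= 2 / (1 - q) * A.
  rewrite oE (le_trans (ler_distD (f t0) _ _))// [X in _ + X]distrC.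
  rewrite (le_trans (lerD (ft0 _ (seg _ zI)) (ft0 _ (seg _ tI))))//.
  by rewrite (_ : _ + _ = 2 / (1 - q) * A)//; field; lra.
have -> : (2 / (1 - q)) `^ p * 18 * (y - x) `^ (2 * g - 2) * B =
    (2 / (1 - q) * A) `^ p.
  have Ap : A `^ p = 18 * B * (y - x) `^ (2 * g - 2).
    rewrite /A -powRrM mulVf ?gt_eqF// powRr1//.
    by rewrite !mulr_ge0 ?powR_ge0 ?(ltW B0).
  have A0 : 0 <= A by exact: powR_ge0.
  by rewrite (@powRM _ _ A p (ltW c0) A0) Ap; ring.
apply: ge0_ler_powR => //; rewrite ?nnegrE ?(ltW p0)//.
  by rewrite oE.
by rewrite mulr_ge0 ?(ltW c0) ?powR_ge0.
Qed.

End gagliardo_kernel.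

(** * Integrals of truncated powers *)

Section power_tail.
Context {R : realType}.
Local Notation mu := (@lebesgue_measure R).

(** Extending by zero below the cut-off lets later integrals run over the whole line, so that no
    domain depends on the other variables when integrals are exchanged. *)
Definition powR_tail (g r x : R) : R := if r <= x then x `^ (- g) else 0.

Lemma powR_tail_ge0 g r x : 0 <= powR_tail g r x.
Proof. by rewrite /powR_tail; case: ifP => // _; exact: powR_ge0. Qed.

Lemma powR_cvgy (a : R) : 0 < a -> (x `^ a @[x --> +oo] --> +oo)%R.
Proof.
move=> a0; apply/cvgryPge => A; near=> x.
have x0 : 0 <= x by near: x; exact: nbhs_pinfty_ge.
have Ax : `|A| `^ a^-1 <= x by near: x; exact: nbhs_pinfty_ge.
rewrite (le_trans (ler_norm A))//.
have -> : `|A| = (`|A| `^ a^-1) `^ a by rewrite -powRrM mulVf ?gt_eqF// powRr1.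
by apply: ge0_ler_powR => //; rewrite ?nnegrE ?powR_ge0// ltW.
Unshelve. all: by end_near. Qed.

Lemma powRN_cvgy0 (a : R) : 0 < a -> (x `^ (- a) @[x --> +oo] --> 0)%R.
Proof.
move=> a0.
rewrite (_ : (fun x => _) = (fun x : R => (x `^ a)^-1)); last first.
  by apply/funext => x; rewrite powRN.
apply/(@gtr0_cvgV0 R R +oo%R _ (fun x => x `^ a)); last exact: powR_cvgy.
by near=> x; apply: powR_gt0; near: x; exact: nbhs_pinfty_gt.
Unshelve. all: by end_near. Qed.

Lemma is_derive_powR_shift (a c t : R) : c < t ->
  is_derive t 1 (fun t => (t - c) `^ a) (a * (t - c) `^ (a - 1)).
Proof.
move=> ct; have tc0 : 0 < t - c by rewrite subr_gt0.
have d1 : is_derive t 1 (fun t => t - c) 1.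
  by apply: is_derive_eq; rewrite subr0.
have := @is_derive1_comp R (@powR R ^~ a) (fun t => t - c) t _ _
  (@is_derive1_powR R a _ tc0) d1.
by rewrite mulr1.
Qed.

(** The antiderivative [(t - c) ^ (1 - g) / (1 - g)] vanishes at infinity because [g > 1]. *)
Lemma integral_powR_itvy (g r c : R) : 1 < g -> 0 < r ->
  (\int[mu]_(t in `[(c + r)%R, +oo[) ((t - c) `^ (- g))%:E =
   (r `^ (1 - g) / (g - 1))%:E)%E.
Proof.
move=> g1 r0.
have dF (t : R) : c < t ->
    is_derive t 1 (fun t => (1 - g)^-1 * (t - c) `^ (1 - g)) ((t - c) `^ (- g)).
  move=> ct; have d := is_derive_powR_shift (1 - g) c t ct.
  have := @is_deriveZ R R R (fun t => (t - c) `^ (1 - g)) (1 - g)^-1 t 1 _ d.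
  rewrite /GRing.scale/= mulKf; last by lra.
  by rewrite (_ : 1 - g - 1 = - g)//; ring.
rewrite (@ge0_continuous_FTC2y R (fun t => (t - c) `^ (- g))
  (fun t => (1 - g)^-1 * (t - c) `^ (1 - g)) (c + r) 0).
- by rewrite -EFinD addrAC subrr !add0r -mulNr -invrN opprB mulrC.
- by move=> x _; exact: powR_ge0.
- apply: derivable_within_continuous => x; rewrite in_itv/= andbT => cx.
  by apply: ex_derive; apply: is_derive_powR_shift; lra.
- rewrite -[X in _ --> X](mulr0 (1 - g)^-1); apply: cvgMr.
  apply: (@cvg_comp _ _ _ (fun t => t - c) (fun x => x `^ (1 - g)) _ +oo).
    exact: cvg_addrr.
  by rewrite -(opprB g 1); apply: powRN_cvgy0; lra.
- by move=> x cx; apply: ex_derive; apply: dF; lra.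
- apply: cvg_at_right_filter.
  have /dF[+ _] : c < c + r by lra.
  by move=> /derivable1_diffP/differentiable_continuous.
- move=> x; rewrite in_itv/= andbT => cx.
  by rewrite derive1E; apply: derive_val; apply: dF; lra.
Qed.

Lemma integral_powR_tailB (g r c : R) : 1 < g -> 0 < r ->
  (\int[mu]_t (powR_tail g r (t - c))%:E = (r `^ (1 - g) / (g - 1))%:E)%E.
Proof.
move=> g1 r0; rewrite -(integral_powR_itvy g r c)// [RHS]integral_mkcond.
apply: eq_integral => t _; rewrite /powR_tail patchE/=.
by rewrite mem_setE in_itv/= andbT lerBrDl; case: ifP.
Qed.

(** The reflection of [t] to [- t] maps the left half-line to a right one with centre [- c]. *)
Lemma integral_powR_tailBr (g r c : R) : 1 < g -> 0 < r ->
  (\int[mu]_t (powR_tail g r (c - t))%:E = (r `^ (1 - g) / (g - 1))%:E)%E.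
Proof.
move=> g1 r0; rewrite -(integral_powR_itvy g r (- c))//.
have -> : (\int[mu]_t (powR_tail g r (c - t))%:E =
  \int[mu]_(t in `]-oo, (- (- c + r))%R]) ((c - t) `^ (- g))%:E)%E.
  rewrite [RHS]integral_mkcond.
  apply: eq_integral => t _; rewrite /powR_tail patchE/=.
  by rewrite mem_setE in_itv/= opprD opprK lerBrDr lerBrDl; case: ifP.
rewrite (@ge0_integration_by_substitutionNy R (fun t => (c - t) `^ (- g))).
- by apply: eq_integral => t _; rewrite /= !opprK addrC.
- apply: derivable_within_continuous => x; rewrite in_itv/= => cx.
  have cx0 : 0 < c - x by lra.
  have d1 : is_derive x 1 (fun t => c - t) (- 1).
    by apply: is_derive_eq; rewrite add0r mul1r.
  by have [+ _] := @is_derive1_comp R (@powR R ^~ (- g)) (fun t => c - t) x _ _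
    (@is_derive1_powR R (- g) _ cx0) d1.
- by move=> x _; exact: powR_ge0.
Qed.

(* Dominates |t - c|^(-g) on |t - c| >= |u - v| / 2, where c = (u + v) / 2. *)
Definition two_tail g (u v t : R) : R :=
  powR_tail g (`|u - v| / 2) (t - (u + v) / 2) +
  powR_tail g (`|u - v| / 2) ((u + v) / 2 - t).

Lemma two_tail_ge0 g u v t : 0 <= two_tail g u v t.
Proof. by rewrite /two_tail addr_ge0 ?powR_tail_ge0. Qed.

Lemma measurable_powR_tail d (T : measurableType d) g (f h : T -> R) :
  measurable_fun setT f -> measurable_fun setT h ->
  measurable_fun setT (fun z => powR_tail g (f z) (h z)).
Proof.
move=> mf mh; rewrite /powR_tail; apply: measurable_fun_ifT => //.
  exact: measurable_fun_ler.
by apply: (measurableT_comp (measurable_powR _)).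
Qed.

Lemma measurable_two_tail d (T : measurableType d) g (u v t : T -> R) :
  measurable_fun setT u -> measurable_fun setT v -> measurable_fun setT t ->
  measurable_fun setT (fun z => two_tail g (u z) (v z) (t z)).
Proof.
move=> mu_ mv mt; rewrite /two_tail.
have mc : measurable_fun setT (fun z => (u z + v z) / 2).
  by apply: measurable_funM => //; exact: measurable_funD.
have mr : measurable_fun setT (fun z => `|u z - v z| / 2).
  apply: measurable_funM => //; apply: measurableT_comp => //.
  exact: measurable_funB.
by apply: measurable_funD; apply: measurable_powR_tail => //;
  exact: measurable_funB.
Qed.

Lemma integral_two_tail g u v : 1 < g -> u != v ->
  (\int[mu]_t (two_tail g u v t)%:E =
   (2 * ((`|u - v| / 2) `^ (1 - g) / (g - 1)))%:E)%E.
Proof.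
move=> g1 uv; have r0 : 0 < `|u - v| / 2.
  by rewrite divr_gt0// normr_gt0 subr_eq0.
rewrite /two_tail; under eq_integral do rewrite EFinD.
rewrite ge0_integralD//.
- by rewrite integral_powR_tailB// integral_powR_tailBr// -EFinD -mulr2n mulr_natl.
- by move=> t _; rewrite lee_fin powR_tail_ge0.
- apply/measurable_EFinP; apply: measurable_powR_tail => //.
  exact: measurable_funB.
- by move=> t _; rewrite lee_fin powR_tail_ge0.
- apply/measurable_EFinP; apply: measurable_powR_tail => //.
  exact: measurable_funB.
Qed.

(** The midpoint of [u] and [v] is at distance at least [|u - v| / 2] and at most [|y - x|] from
    both [x] and [y]. Giving half of the exponent to each endpoint decouples [x] from [y]. *)
Lemma two_tail_segment g (x y u v : R) : 0 < g -> u != v ->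
  segment x y u -> segment x y v ->
  `|y - x| `^ (- (2 * g)) <= two_tail g u v y * two_tail g u v x.
Proof.
move=> g0 uv; rewrite /segment/= !in_itv/=.
wlog xy : x y / x <= y => [H|].
  case/orP: (le_total x y) => [|yx]; first exact: H.
  by rewrite minC maxC distrC [two_tail g u v y * _]mulrC; exact: H.
rewrite (min_idPl xy) (max_idPr xy) => /andP[xu uy] /andP[xv vy].
set c := (u + v) / 2; set r := `|u - v| / 2.
have r0 : 0 < r by rewrite divr_gt0// normr_gt0 subr_eq0.
have ry : r <= y - c by rewrite /r /c; case: (ltrgt0P (u - v)); lra.
have rx : r <= c - x by rewrite /r /c; case: (ltrgt0P (u - v)); lra.
have decr (a b : R) : 0 < a -> a <= b -> b `^ (- g) <= a `^ (- g).
  move=> a0 ab; have b0 := lt_le_trans a0 ab.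
  rewrite !powRN lef_pV2 ?posrE ?powR_gt0//.
  by apply: ge0_ler_powR => //; rewrite ?nnegrE ltW.
have yT : `|y - x| `^ (- g) <= two_tail g u v y.
  rewrite /two_tail -/c -/r /powR_tail ry.
  apply: (@le_trans _ _ ((y - c) `^ (- g)));
    last by rewrite lerDl; exact: powR_tail_ge0.
  by apply: decr; rewrite ?ger0_norm; lra.
have xT : `|y - x| `^ (- g) <= two_tail g u v x.
  rewrite /two_tail -/c -/r /powR_tail rx.
  apply: (@le_trans _ _ ((c - x) `^ (- g)));
    last by rewrite lerDr; exact: powR_tail_ge0.
  by apply: decr; rewrite ?ger0_norm; lra.
rewrite (_ : - (2 * g) = - g + - g); last by ring.
rewrite powRD; last by apply/implyP => _; rewrite normr_eq0; lra.
by apply: ler_pM; rewrite ?powR_ge0.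
Qed.

End power_tail.

(** * Symmetry of the oscillation and exchange of two double integrals *)

Lemma oscC (R : realType) (f : R -> R) (x y : R) : osc f x y = osc f y x.
Proof. by rewrite /osc /segment minC maxC. Qed.

(** Four exchanges of adjacent integrals: [x] moves past [u] and then [v] with [y] fixed, after
    which [y] moves past both. *)
Lemma tonelli_pairs d1 d2 (T1 : measurableType d1) (T2 : measurableType d2)
    (R : realType) (m1 : {sigma_finite_measure set T1 -> \bar R})
    (m2 : {sigma_finite_measure set T2 -> \bar R})
    (K : (T1 * T1) * (T2 * T2) -> \bar R) :
  measurable_fun setT K -> (forall z, 0 <= K z)%E ->
  (\int[m1]_y \int[m1]_x \int[m2]_u \int[m2]_v K ((y, x), (u, v)) =
   \int[m2]_u \int[m2]_v \int[m1]_y \int[m1]_x K ((y, x), (u, v)))%E.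
Proof.
move=> mK K0.
have mKc d (Z : measurableType d) (y x : Z -> T1) (u v : Z -> T2) :
    measurable_fun setT y -> measurable_fun setT x ->
    measurable_fun setT u -> measurable_fun setT v ->
    measurable_fun setT (fun z => K ((y z, x z), (u z, v z))).
  move=> my mx mu mv; apply: (measurableT_comp mK).
  by apply: measurable_fun_pair; apply: measurable_fun_pair.
transitivity (\int[m1]_y \int[m2]_u \int[m2]_v \int[m1]_x K ((y, x), (u, v)))%E.
  apply: eq_integral => y _.
  rewrite (fubini_tonelli (fun w => \int[m2]_v K ((y, w.1), (w.2, v)))%E); last 2 first.
  - apply: (measurable_fun_fubini_tonelli_F
      (fun z => K ((y, z.1.1), (z.1.2, z.2)))) => //.
    by apply: mKc => //; apply: measurableT_comp.
  - by move=> w; exact: integral_ge0.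
  apply: eq_integral => u _.
  rewrite (fubini_tonelli (fun w => K ((y, w.1), (u, w.2))))//.
  exact: mKc.
rewrite (fubini_tonelli
  (fun w => \int[m2]_v \int[m1]_x K ((w.1, x), (w.2, v)))%E); last 2 first.
- apply: (measurable_fun_fubini_tonelli_F
    (fun z => \int[m1]_x K ((z.1.1, x), (z.1.2, z.2)))%E).
    apply: (measurable_fun_fubini_tonelli_F
      (fun z => K ((z.1.1.1, z.2), (z.1.1.2, z.1.2)))) => //.
    by apply: mKc => //; do ?apply: measurableT_comp.
  by move=> z; exact: integral_ge0.
- by move=> w; apply: integral_ge0 => v _; exact: integral_ge0.
apply: eq_integral => u _.
rewrite (fubini_tonelli (fun w => \int[m1]_x K ((w.1, x), (u, w.2)))%E)//.
  apply: (measurable_fun_fubini_tonelli_F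
    (fun z => K ((z.1.1, z.2), (u, z.1.2)))) => //.
  by apply: mKc => //; apply: measurableT_comp.
by move=> w; exact: integral_ge0.
Qed.

(** * Pointwise domination of the oscillation and integration of the dominating kernel *)

Section osc_integral.
Context {R : realType}.
Local Notation mu := (@lebesgue_measure R).

Lemma ge0_le_integral_subT (D : set R) (f h : R -> \bar R) :
  (forall x, 0 <= f x)%E -> (forall x, 0 <= h x)%E ->
  (forall x, D x -> f x <= h x)%E ->
  (\int[mu]_(x in D) f x <= \int[mu]_x h x)%E.
Proof.
move=> f0 h0 fh; rewrite integral_mkcond; apply: ge0_le_integralT => x.
  by rewrite patchE; case: ifP.
by rewrite patchE; case: ifPn => //; rewrite inE => /fh.
Qed.

Lemma osc_le_ereal (p g : R) : 0 < p -> 1 < g ->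
  exists2 M : R, 0 < M & forall (f : R -> R) (x y : R), continuous f -> x != y ->
  ((osc f x y `^ p)%:E <= (M * `|y - x| `^ (2 * g - 2))%:E *
    \int[mu]_(u in segment x y) \int[mu]_(v in segment x y)
     (gagliardo f p (2 * g) (u, v))%:E)%E.
Proof.
move=> p0 g1; have [M M0 MB] := osc_le_gagliardo p g p0 g1.
exists M => // f x y cf.
wlog xy : x y / x < y => [H xy|_].
  case/orP: (lt_total xy) => [xy'|yx]; first exact: H.
  by rewrite oscC distrC /segment minC maxC; apply: H => //; rewrite eq_sym.
rewrite /segment (min_idPl (ltW xy)) (max_idPr (ltW xy)) gtr0_norm ?subr_gt0//.
have c0 : 0 < M * (y - x) `^ (2 * g - 2).
  by rewrite mulr_gt0// powR_gt0// subr_gt0.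
set I := (X in (_ <= _ * X)%E).
have I0 : (0 <= I)%E.
  apply: integral_ge0 => u _; apply: integral_ge0 => v _.
  by rewrite lee_fin gagliardo_ge0.
have [Ioo|Ifin] := eqVneq I +oo%E.
  by rewrite Ioo gt0_muley ?lte_fin// leey.
have If : I \is a fin_num by rewrite ge0_fin_numE// ltey.
rewrite -(fineK If) -EFinM lee_fin; apply/ler_addgt0Pr => e e0.
have b0 : 0 <= fine I by exact: fine_ge0.
(* [osc_le_gagliardo] asks for a positive bound while the integral may vanish; the added term
   contributes exactly [e] after multiplication. *)
have B0 : 0 < fine I + e / (M * (y - x) `^ (2 * g - 2)).
  by rewrite ltr_wpDl// divr_gt0.
have -> : M * (y - x) `^ (2 * g - 2) * fine I + e =
    M * (y - x) `^ (2 * g - 2) * (fine I + e / (M * (y - x) `^ (2 * g - 2))).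
  by rewrite mulrDr [_ * (e / _)]mulrC divfK ?gt_eqF.
apply: (MB f x y _ cf xy B0).
by rewrite EFinD (fineK If) leeDl// lee_fin divr_ge0 ?ltW.
Qed.

(** The coordinates are [((y, x), (u, v))]. For fixed [u] and [v] this is a function of [y] times a
    function of [x], so its integral over [x] and [y] factors. *)
Definition split_kernel (f : R -> R) (p g : R) (z : (R * R) * (R * R)) : R :=
  two_tail g z.2.1 z.2.2 z.1.1 * two_tail g z.2.1 z.2.2 z.1.2 *
  gagliardo f p (2 * g) z.2.

Lemma split_kernel_ge0 f p g z : 0 <= split_kernel f p g z.
Proof. by rewrite /split_kernel !mulr_ge0 ?two_tail_ge0 ?gagliardo_ge0. Qed.

Lemma measurable_split_kernel f p g : continuous f ->
  measurable_fun [set: (R * R) * (R * R)] (split_kernel f p g).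
Proof.
move=> cf; apply: measurable_funM; last first.
  by apply: (measurableT_comp (measurable_gagliardo _ _ _ cf)).
by apply: measurable_funM; apply: measurable_two_tail => //;
  apply: measurableT_comp.
Qed.

Lemma osc_le_split_kernel (p g : R) : 0 < p -> 1 < g ->
  exists2 M : R, 0 < M & forall (f : R -> R) (x y : R), continuous f ->
  ((osc f x y `^ p / `|y - x| `^ (4 * g - 2))%:E <=
   \int[mu]_u \int[mu]_v (M * split_kernel f p g ((y, x), (u, v)))%:E)%E.
Proof.
move=> p0 g1; have [M M0 MB] := osc_le_ereal p g p0 g1.
exists M => // f x y cf.
have SK0 u v : (0 <= (M * split_kernel f p g ((y, x), (u, v)))%:E)%E.
  by rewrite lee_fin mulr_ge0 ?split_kernel_ge0 ?(ltW M0).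
(* On the diagonal the left side is zero, because the inverse of zero is zero. *)
have [xy|xy] := eqVneq x y.
  have -> : y - x = 0 by rewrite xy subrr.
  rewrite normr0 powR0 ?invr0 ?mulr0; last by lra.
  by apply: integral_ge0 => u _; apply: integral_ge0.
have h0 : 0 < `|y - x| by rewrite normr_gt0 subr_eq0 eq_sym.
have mF := measurable_gagliardo f p (2 * g) cf.
have mS : measurable (segment x y) by rewrite /segment.
have mF1 u : measurable_fun (segment x y)
    (fun v => (gagliardo f p (2 * g) (u, v))%:E).
  apply/measurable_EFinP; apply: measurable_funTS.
  exact: measurableT_comp mF (measurable_pair1 _).
have F0 u v : (0 <= (gagliardo f p (2 * g) (u, v))%:E)%E.
  by rewrite lee_fin gagliardo_ge0.
have w0 : 0 <= M * `|y - x| `^ (- (2 * g)) by rewrite mulr_ge0 ?powR_ge0 ?(ltW M0).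
rewrite EFinM muleC.
apply: (@le_trans _ _ (((`|y - x| `^ (4 * g - 2))^-1)%:E *
  ((M * `|y - x| `^ (2 * g - 2))%:E *
    \int[mu]_(u in segment x y) \int[mu]_(v in segment x y)
     (gagliardo f p (2 * g) (u, v))%:E))%E).
  by apply: lee_wpmul2l; [rewrite lee_fin invr_ge0 powR_ge0|exact: MB].
rewrite muleA -EFinM.
(* The resulting power [- (2 * g)] is the one that [two_tail_segment] splits. *)
have -> : (`|y - x| `^ (4 * g - 2))^-1 * (M * `|y - x| `^ (2 * g - 2)) =
    M * `|y - x| `^ (- (2 * g)).
  rewrite -powRN mulrCA -powRD; last by apply/implyP => _; rewrite gt_eqF.
  by congr (_ * _ `^ _); ring.
rewrite -ge0_integralZl//; last 2 first.
- apply: measurable_funTS.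
  by apply: measurable_section_integral => // z; exact: gagliardo_ge0.
- by move=> u _; apply: integral_ge0.
apply: ge0_le_integral_subT => [u|u|u uS].
- by rewrite mule_ge0//; apply: integral_ge0.
- by apply: integral_ge0.
rewrite -ge0_integralZl//; last exact: mF1.
apply: ge0_le_integral_subT => [v|//|v vS].
  by rewrite mule_ge0.
rewrite -EFinM lee_fin -mulrA ler_wpM2l ?(ltW M0)// /split_kernel/=.
have [->|uv] := eqVneq u v; first by rewrite gagliardo_diag ?mulr0 ?gt_eqF.
by rewrite ler_wpM2r ?gagliardo_ge0// two_tail_segment//; lra.
Qed.

(** Each of the two tail integrals contributes a factor [|u - v| ^ (1 - g)]; together with
    [|u - v| ^ (- 2 g)] they restore the exponent [- (4 g - 2)]. For [u = v] both sides vanish. *)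
Lemma integral_split_kernel (p g k : R) (f : R -> R) (u v : R) :
  0 < p -> 1 < g -> 0 <= k ->
  (\int[mu]_y \int[mu]_x (k * split_kernel f p g ((y, x), (u, v)))%:E =
   (k * (2 * (2^-1 `^ (1 - g) / (g - 1))) ^+ 2 *
      gagliardo f p (4 * g - 2) (u, v))%:E)%E.
Proof.
move=> p0 g1 k0.
have [->|uv] := eqVneq u v.
  rewrite gagliardo_diag ?mulr0 ?gt_eqF//.
  apply: integral0_eq => y _; apply: integral0_eq => x _.
  by rewrite /split_kernel/= gagliardo_diag ?mulr0 ?gt_eqF.
have mT : measurable_fun [set: R] (fun t => (two_tail g u v t)%:E).
  by apply/measurable_EFinP; exact: measurable_two_tail.
have T0 t : (0 <= (two_tail g u v t)%:E)%E by rewrite lee_fin two_tail_ge0.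
set F := gagliardo f p (2 * g) (u, v).
have F0 : 0 <= F by exact: gagliardo_ge0.
set I := 2 * ((`|u - v| / 2) `^ (1 - g) / (g - 1)).
have I0 : 0 <= I.
  by rewrite mulr_ge0// divr_ge0 ?powR_ge0// subr_ge0 ltW.
have kF0 : 0 <= k * F by rewrite mulr_ge0.
transitivity (\int[mu]_y ((k * F * I)%:E * (two_tail g u v y)%:E))%E.
  apply: eq_integral => y _.
  transitivity
    (\int[mu]_x ((k * F * two_tail g u v y)%:E * (two_tail g u v x)%:E))%E.
    apply: eq_integral => x _; rewrite /split_kernel/= -/F -EFinM.
    by congr EFin; ring.
  have kFT0 : 0 <= k * F * two_tail g u v y by rewrite mulr_ge0 ?two_tail_ge0.
  rewrite ge0_integralZl ?lee_fin//.
  by rewrite integral_two_tail// -/I -!EFinM; congr EFin; ring.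
have kFI0 : 0 <= k * F * I by rewrite mulr_ge0.
rewrite ge0_integralZl ?lee_fin//.
rewrite integral_two_tail// -/I -EFinM; congr EFin.
have d0 : 0 < `|u - v| by rewrite normr_gt0 subr_eq0.
rewrite /I /F /gagliardo/= powRM//.
rewrite -!powRN (_ : - (4 * g - 2) = - (2 * g) + ((1 - g) + (1 - g))); last by ring.
rewrite !powRD; [|by apply/implyP => _; rewrite gt_eqF..].
by ring.
Qed.

End osc_integral.

(** * From the pointwise bound to the inequality of double integrals *)

Theorem mainTheorem4 (R : realType) (s p : R)
    (hs0 : 0 < s) (hs1 : s < 1) (hp : 1 < p) (hsp : 1 < s * p) :
  exists C : R, forall f : R -> R, continuous f ->
    (\int[lebesgue_measure]_(y in [set: R]) \int[lebesgue_measure]_(x in [set: R])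
        ((osc f x y `^ p) / (`|y - x| `^ (1 + s * p)))%:E
     <= C%:E *
        \int[lebesgue_measure]_(y in [set: R]) \int[lebesgue_measure]_(x in [set: R])
          ((`|f y - f x| `^ p) / (`|y - x| `^ (1 + s * p)))%:E)%E.
Proof.
have p0 : 0 < p by lra.
pose g := (s * p + 3) / 4.
have g1 : 1 < g by rewrite /g; lra.
have -> : 1 + s * p = 4 * g - 2 by rewrite /g; field.
have [M M0 MB] := osc_le_split_kernel p g p0 g1.
set c := (2 * (2^-1 `^ (1 - g) / (g - 1))) ^+ 2.
have c0 : 0 <= c by exact: sqr_ge0.
(* [M] and [c] are built from [p] and [g] before [f] is introduced. *)
exists (M * c) => f cf.
have K0 := split_kernel_ge0 f p g.
have mK := measurable_split_kernel f p g cf.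
have osc0 y x : (0 <= (osc f x y `^ p / `|y - x| `^ (4 * g - 2))%:E)%E.
  by rewrite lee_fin divr_ge0 ?powR_ge0.
apply: (@le_trans _ _ (\int[lebesgue_measure]_y \int[lebesgue_measure]_x
   \int[lebesgue_measure]_u \int[lebesgue_measure]_v
      (M * split_kernel f p g ((y, x), (u, v)))%:E)%E).
  apply: ge0_le_integralT => y; first exact: integral_ge0.
  by apply: ge0_le_integralT => x //; exact: MB.
rewrite (@tonelli_pairs _ _ _ _ R lebesgue_measure lebesgue_measure
  (fun z => (M * split_kernel f p g z)%:E)); last 2 first.
- by apply/measurable_EFinP; exact: measurable_funM.
- by move=> z; rewrite lee_fin mulr_ge0// ltW.
have mG := measurable_gagliardo f p (4 * g - 2) cf.
have G0 := gagliardo_ge0 f p (4 * g - 2).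
have Mc0 : 0 <= M * c by rewrite mulr_ge0// ltW.
rewrite -ge0_integralZl ?lee_fin//; last 2 first.
- exact: (measurable_section_integral _ _ measurableT mG G0).
- by move=> u _; apply: integral_ge0 => v _; exact: (G0 (u, v)).
(* After the exchange the integral over [y] and [x] is computed exactly, so what remains is an
   equality. *)
rewrite le_eqVlt; apply/orP; left; apply/eqP; apply: eq_integral => u _.
rewrite -ge0_integralZl ?lee_fin//; last first.
  apply/measurable_EFinP.
  exact: (measurableT_comp mG (measurable_pair1 u)).
apply: eq_integral => v _.
by rewrite integral_split_kernel// ltW.
Qed.
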